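(* Let $n\ge2$, let $X_{n+2}$ be the affine cone over the Grassmannian $\mathrm{Gr}_{2,n+2}$ in its Plücker embedding, and let $\mathbb{Z}[X_{n+2}]\subset\mathbb{C}[X_{n+2}]$ be the subring generated by the Plücker coordinates $\Delta_{ab}$, $1\le a<b\le n+2$. Let $\mathcal{A}_\circ$ be the special cluster algebra of type $B_n$ defined in the context, whose cluster variables (resp. coefficient generators) are labeled by the $\Theta$-orbits of diagonals (resp. sides) of a regular $(2n+2)$-gon with vertices labeled $1,\dots,n+1,\overline1,\dots,\overline{n+1}$ in counterclockwise order. The correspondence sending each cluster variable and each coefficient for $\mathcal{A}_\circ$ to the element with the same label in the list $$[a,\overline a]\mapsto\Delta_{a\overline a}=\Delta_{a,n+2}\quad(1\le a\le n+1),$$ $$\{[a,b],[\overline a,\overline b]\}\mapsto\Delta_{ab}\quad(1\le a<b\le n+1),$$ $$\{[a,\overline b],[\overline a,b]\}\mapsto\Delta_{a\overline b}=\Delta_{a,n+2}\Delta_{b,n+2}-\Delta_{ab}\quad(1\le a<b\le n+1)$$ extends uniquely to an algebra isomorphism of $\mathcal{A}_\circ$ with $\mathbb{Z}[X_{n+2}]$.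
   Context: Cluster algebras. A semifield $(\mathbb{P},\oplus,\cdot)$ is an abelian multiplicative group with a commutative, associative operation $\oplus$ over which multiplication distributes. $\mathrm{Trop}(p_j:j\in J)$ ($J$ finite) is the semifield whose multiplicative group is free abelian on the $p_j$, with $\prod_jp_j^{a_j}\oplus\prod_jp_j^{b_j}=\prod_jp_j^{\min(a_j,b_j)}$. The ambient field $\mathcal{F}$ is isomorphic to the field of rational functions in $n$ variables with coefficients in $\mathbb{Z}\mathbb{P}$. A seed is $(\mathbf{x},\mathbf{p},B)$ with $\mathbf{x}\subset\mathcal{F}$ an $n$-element transcendence basis over the fraction field of $\mathbb{Z}\mathbb{P}$; $\mathbf{p}=(p_x^\pm)_{x\in\mathbf{x}}$ in $\mathbb{P}$ with $p_x^+\oplus p_x^-=1$; $B=(b_{xy})_{x,y\in\mathbf{x}}$ an integer matrix with, for all $x,y$, either $b_{xy}=b_{yx}=0$ or $b_{xy}b_{yx}<0$. Mutation at $z\in\mathbf{x}$: replace $z$ by $\overline z$ given by the exchange relation $z\overline z=p_z^+\prod_{b_{xz}>0}x^{b_{xz}}+p_z^-\prod_{b_{xz}<0}x^{-b_{xz}}$; new coefficients are normalized and satisfy $\overline p_x^+/\overline p_x^-=p_z^-/p_z^+$ if $x=\overline z$, $=(p_z^+)^{b_{zx}}p_x^+/p_x^-$ if $b_{zx}\ge0$, $=(p_z^-)^{b_{zx}}p_x^+/p_x^-$ if $b_{zx}\le0$; $B$ is replaced by $b'_{xy}=-b_{xy}$ if $x=z$ or $y=z$, $b'_{xy}=b_{xy}+\frac{|b_{xz}|b_{zy}+b_{xz}|b_{zy}|}{2}$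 otherwise, with the index $z$ relabeled $\overline z$. The cluster algebra generated from an initial seed is the subring of $\mathcal{F}$ generated by all cluster variables (elements of the sets $\mathbf{x}$) and all coefficients $p_x^\pm$ of all seeds obtained by iterated mutations. It is of type $B_n$ if some seed matrix $B$ has Cartan counterpart ($a_{xx}=2$, $a_{xy}=-|b_{xy}|$ for $x\neq y$) the Cartan matrix of type $B_n$, in the convention $a_{n-1,n}=-1$, $a_{n,n-1}=-2$. The algebra $\mathcal{A}_\circ$ of type $B_n$. Let $\Theta$ be the $180^\circ$ rotation of the regular $(2n+2)$-gon $\mathbf{P}_{2n+2}$, and $\overline a=\Theta(a)$ the vertex antipodal to $a$ (so $\overline{\overline a}=a$). The $\Theta$-orbits of diagonals are the diameters $[a,\overline a]$ and the pairs $\{[a,b],[\overline a,\overline b]\}$ of centrally symmetric non-diameter diagonals. Let $\mathbb{P}=\mathrm{Trop}(p_\delta)$, where $\delta$ runs over the $n+1$ centrally symmetric pairs of sides; for $\delta=\{[a,b],[\overline a,\overline b]\}$ write $p_\delta=p_{ab}=p_{\overline a\,\overline b}$. $\mathcal{A}_\circ$ is the cluster algebra of type $B_n$ over $\mathbb{P}$ whose cluster variables $x_{ab}=x_{ba}=x_{\overline a\,\overline b}$ are labeled by the $\Theta$-orbits of diagonals $[a,b]$, whose clusters correspond to the $\Theta$-invariant triangulations of $\mathbf{P}_{2n+2}$ by non-crossing diagonals, and whose exchange relations are the following (with the convention $x_{ab}=1$ if $[a,b]$ is a side): (1) $x_{ac}x_{bd}=p^+x_{ab}x_{cd}+p^-x_{ad}x_{bc}$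 whenever $a,b,c,d,\overline a$ are in counterclockwise order; (2) $x_{ac}x_{a\overline b}=p^+x_{ab}x_{a\overline c}+p^-x_{a\overline a}^2x_{bc}$ whenever $a,b,c,\overline a$ are in counterclockwise order; (3) $x_{a\overline a}x_{b\overline b}=p^+x_{ab}+p^-x_{a\overline b}$ whenever $a,b,\overline a$ are in counterclockwise order. Here, in each relation, the coefficient of a monomial is obtained from that monomial by replacing each factor $x_{ab}$ by $1$ if $[a,b]$ is a diagonal and by $p_{ab}$ if $[a,b]$ is a side. Such a cluster algebra exists, and the matrix and coefficients of a seed are read off from the exchange relations, up to the simultaneous change $B\to-B$, $p^+\leftrightarrow p^-$, which does not affect the algebra. The affine cone over $\mathrm{Gr}_{2,m}$ is the variety of decomposable bivectors in $\bigwedge^2\mathbb{C}^m$, with Plücker coordinates $\Delta_{ab}$; equivalently, $\mathbb{Z}[X_m]$ is the ring generated by the $2\times2$ minors $\Delta_{ab}=z_{1a}z_{2b}-z_{1b}z_{2a}$ of a generic $2\times m$ matrix. *)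

(* Defs.v *)
From HB Require Import structures.
From mathcomp Require Import all_boot all_order all_fingroup all_algebra.
From mathcomp Require Import fraction.
From mathcomp.multinomials Require Import mpoly.
From mathcomp.classical Require Import boolp.

Set Implicit Arguments.
Unset Strict Implicit.
Unset Printing Implicit Defensive.

Import Order.TTheory GRing.Theory Num.Theory.
Local Open Scope ring_scope.

Definition in_gen_subring (R : comNzRingType) (G : R -> Prop) : {pred R} :=
  fun x => `[< forall S : {pred R}, subring_closed S ->
                 (forall g, G g -> g \in S) -> x \in S >].

Lemma in_gen_subring_closed (R : comNzRingType) (G : R -> Prop) :
  subring_closed (in_gen_subring G).
Proof.
split=> [|x y /asboolP xS /asboolP yS|x y /asboolP xS /asboolP yS];
  apply/asboolP => S Scl GS; case: (Scl) => S1 SB SM //.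
- by apply: SB; [apply: xS | apply: yS].
- by apply: SM; [apply: xS | apply: yS].
Qed.

HB.instance Definition _ (R : comNzRingType) (G : R -> Prop) :=
  GRing.isSubringClosed.Build R (in_gen_subring G) (in_gen_subring_closed G).

Record gen_subring (R : comNzRingType) (G : R -> Prop) := GenSubring {
  gen_subring_val :> R;
  _ : gen_subring_val \in in_gen_subring G
}.

HB.instance Definition _ (R : comNzRingType) (G : R -> Prop) :=
  [isSub for @gen_subring_val R G].
HB.instance Definition _ (R : comNzRingType) (G : R -> Prop) :=
  [Choice of gen_subring G by <:].
HB.instance Definition _ (R : comNzRingType) (G : R -> Prop) :=
  [SubChoice_isSubComNzRing of gen_subring G by <:].

(* An element of Trop(p_j : j < m) is given by its exponent vector, so that the
   multiplication, the inverse and the unit of the semifield are +, - and 0 of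
   the additive group {ffun 'I_m -> int}; the auxiliary addition is oplus. *)
Definition trop (m : nat) := {ffun 'I_m -> int}.

Definition oplus m (p q : trop m) : trop m := [ffun j => Num.min (p j) (q j)].

(* The field of fractions of ZP, where ZP is the ring of Laurent polynomials
   in the p_j with integer coefficients. *)
Definition fracZP (m : nat) : fieldType := {fraction {mpoly int[m]}}.

Section ClusterAlgebra.

(* r is the rank; F is the ambient field, an extension of Frac(ZP) through
   kappa. *)
Variables (m r : nat) (F : fieldType) (kappa : {rmorphism fracZP m -> F}).

Definition is_ambient_field : Prop :=
  exists2 psi : {rmorphism {fraction {mpoly (fracZP m)[r]}} -> F},
    bijective psi & forall c : fracZP m, psi (tofrac c%:MP_[r]) = kappa c.

(* the image in F of an element of the coefficient group *)
Definition tropF (p : trop m) : F :=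
  \prod_(j < m) kappa (tofrac 'X_j) ^ p j.

(* Algebraicity over the subfield Frac(ZP)(x) is expressed by a nonzero
   polynomial equation with coefficients in Frac(ZP)[x], clearing
   denominators. *)
Definition transcendence_basis (x : 'I_r -> F) : Prop :=
  (forall f : {mpoly (fracZP m)[r]}, mmap kappa x f = 0 -> f = 0) /\
  (forall y : F, exists2 q : {poly {mpoly (fracZP m)[r]}},
     map_poly (mmap kappa x) q != 0 & root (map_poly (mmap kappa x) q) y).

(* The elements of the cluster are numbered by 'I_r; their order is immaterial,
   and mutation at k puts the new cluster variable in position k. *)
Record seed := Seed {
  cluster : 'I_r -> F;
  coef_pos : 'I_r -> trop m;
  coef_neg : 'I_r -> trop m;
  exmx : 'M[int]_r
}.

Definition normalized (S : seed) : Prop :=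
  forall i, oplus (coef_pos S i) (coef_neg S i) = 0.

Definition sign_skew_symmetric (B : 'M[int]_r) : Prop :=
  forall i j, (B i j = 0 /\ B j i = 0) \/ B i j * B j i < 0.

Definition is_seed (S : seed) : Prop :=
  [/\ transcendence_basis (cluster S), normalized S
    & sign_skew_symmetric (exmx S)].

Definition mutate_mx (k : 'I_r) (B : 'M[int]_r) : 'M[int]_r :=
  \matrix_(i, j) if (i == k) || (j == k) then - B i j
                 else B i j + ((`|B i k| * B k j + B i k * `|B k j|) %/ 2)%Z.

Definition mutation (k : 'I_r) (S S' : seed) : Prop :=
  let x := cluster S in
  let B := exmx S in
  [/\ (forall i, i != k -> cluster S' i = x i),
      x k * cluster S' k =
        tropF (coef_pos S k) * \prod_(i < r | 0 < B i k) x i ^ B i k +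
        tropF (coef_neg S k) * \prod_(i < r | B i k < 0) x i ^ (- B i k),
      normalized S',
      (forall i, coef_pos S' i - coef_neg S' i =
         if i == k then coef_neg S k - coef_pos S k
         else (if 0 <= B k i then coef_pos S k else coef_neg S k) *~ B k i
              + (coef_pos S i - coef_neg S i))
    & exmx S' = mutate_mx k B].

Inductive reachable (S0 : seed) : seed -> Prop :=
| reachable_init : reachable S0 S0
| reachable_mutation k S S' :
    reachable S0 S -> mutation k S S' -> reachable S0 S'.

Inductive cluster_generator (S0 : seed) : F -> Prop :=
| cluster_generator_var S i :
    reachable S0 S -> cluster_generator S0 (cluster S i)
| cluster_generator_coef_pos S i :
    reachable S0 S -> cluster_generator S0 (tropF (coef_pos S i))
| cluster_generator_coef_neg S i :
    reachable S0 S -> cluster_generator S0 (tropF (coef_neg S i)).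

Definition cluster_algebra (S0 : seed) : comNzRingType :=
  gen_subring (cluster_generator S0).

Definition cartan_counterpart (B : 'M[int]_r) : 'M[int]_r :=
  \matrix_(i, j) if i == j then 2 else - `|B i j|.

(* With indices starting from 0, the entry a_{n,n-1} = -2 is the one in row
   r - 1 and column r - 2. *)
Definition cartan_typeB : 'M[int]_r :=
  \matrix_(i, j)
    if i == j then 2
    else if (i == j.+1 :> nat) && (i.+1 == r :> nat) then - 2
    else if (i == j.+1 :> nat) || (j == i.+1 :> nat) then - 1
    else 0.

Definition of_typeB (S0 : seed) : Prop :=
  exists2 S, reachable S0 S &
    exists s : 'S_r, forall i j,
      cartan_counterpart (exmx S) (s i) (s j) = cartan_typeB i j.

(* The factors, with multiplicities, of the two cluster monomials in the
   right-hand side of the exchange relation for the k-th cluster variable. *)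
Definition factorsp (S : seed) (k : 'I_r) : seq F :=
  flatten [seq nseq `|exmx S i k| (cluster S i)
          | i <- enum 'I_r & 0 < exmx S i k].
Definition factorsm (S : seed) (k : 'I_r) : seq F :=
  flatten [seq nseq `|exmx S i k| (cluster S i)
          | i <- enum 'I_r & exmx S i k < 0].

End ClusterAlgebra.

(* The vertices in counterclockwise order, as residues mod 2n+2; the type is
   'Z_(2n+2), so + and - are taken mod 2n+2.  The vertices 1, ..., n+1 are the
   residues 0, ..., n, and their antipodes are n+1, ..., 2n+1. *)
Definition vertex (n : nat) := 'I_(n.*2).+2.

Definition vtx n (a : 'I_n.+1) : vertex n := inord a.

Definition antip n (a : vertex n) : vertex n := a + n.+1%:R.

(* a, followed by the elements of s, is in (strict) counterclockwise order *)
Definition ccw n (a : vertex n) (s : seq (vertex n)) : bool :=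
  sorted ltn [seq nat_of_ord (v - a) | v <- a :: s].

(* Sides and diagonals are represented by the set of their two endpoints. *)
Definition chord (n : nat) := {set vertex n}.

Definition theta n (d : chord n) : chord n := [set antip a | a in d].

Definition is_side n (d : chord n) : bool := [exists a, d == [set a; a + 1]].

Definition is_diag n (d : chord n) : bool := (#|d| == 2) && ~~ is_side d.

Definition crossing n (d e : chord n) : bool :=
  [exists a, exists b, exists a', exists b',
     [&& ccw a [:: b; a'; b'], d == [set a; a'] & e == [set b; b']]].

Definition noncrossing_diags n (T : {set chord n}) : bool :=
  [forall d in T, is_diag d && [forall e in T, ~~ crossing d e]].

Definition triangulation n (T : {set chord n}) : bool :=
  maxset (@noncrossing_diags n) T.

Definition theta_triangulation n (T : {set chord n}) : bool :=
  triangulation T && [forall d in T, theta d \in T].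

(* the j-th pair of centrally symmetric sides *)
Definition side_orbit n (j : 'I_n.+1) : {set chord n} :=
  [set [set vtx j; vtx j + 1]; theta [set vtx j; vtx j + 1]].

(* p_d if d is a side (a generator of Trop), and 1 otherwise *)
Definition side_coef n (d : chord n) : trop n.+1 :=
  [ffun j => (d \in side_orbit j)%:Z].

(* A monomial x_{d1} ... x_{dk} is represented by the sequence of chords
   [:: d1; ...; dk]. *)
Definition monomial_coef n (M : seq (chord n)) : trop n.+1 :=
  \sum_(d <- M) side_coef d.

(* exchange_data d d' M1 M2 says that x_d x_d' = p^+ M1 + p^- M2 is one of the
   exchange relations of the (2n+2)-gon; its coefficients are determined by M1 and M2, see
   monomial_coef. *)
Inductive exchange_data n :
  chord n -> chord n -> seq (chord n) -> seq (chord n) -> Prop :=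
| Exchange1 (a b c d : vertex n) of ccw a [:: b; c; d; antip a] :
    exchange_data [set a; c] [set b; d]
      [:: [set a; b]; [set c; d]] [:: [set a; d]; [set b; c]]
| Exchange2 (a b c : vertex n) of ccw a [:: b; c; antip a] :
    exchange_data [set a; c] [set a; antip b]
      [:: [set a; b]; [set a; antip c]]
      [:: [set a; antip a]; [set a; antip a]; [set b; c]]
| Exchange3 (a b : vertex n) of ccw a [:: b; antip a] :
    exchange_data [set a; antip a] [set b; antip b]
      [:: [set a; b]] [:: [set a; antip b]].

Section Acirc.

Variables (n : nat) (F : fieldType) (kappa : {rmorphism fracZP n.+1 -> F}).

(* The coefficient p and the cluster monomial with factors fs are those of the
   monomial M; factors which are sides do not contribute to fs since x = 1 on
   sides. *)
Definition monomial_is (x : chord n -> F) (p : trop n.+1) (fs : seq F)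
    (M : seq (chord n)) : Prop :=
  p = monomial_coef M /\ perm_eq fs [seq x d | d <- M & is_diag d].

(* The exchange relation z z' = p_z^+ (...) + p_z^- (...) for the mutation of S
   at k, with z' the new variable, is the relation x_d x_d' = p^+ M1 + p^- M2;
   neither z and z' nor the two terms of the right-hand side are ordered. *)
Definition exchange_is (x : chord n -> F) (S : seed n.+1 n F) (k : 'I_n)
    (z' : F) (d d' : chord n) (M1 M2 : seq (chord n)) : Prop :=
  ((cluster S k = x d /\ z' = x d') \/ (cluster S k = x d' /\ z' = x d)) /\
  ((monomial_is x (coef_pos S k) (factorsp S k) M1 /\
    monomial_is x (coef_neg S k) (factorsm S k) M2) \/
   (monomial_is x (coef_pos S k) (factorsp S k) M2 /\
    monomial_is x (coef_neg S k) (factorsm S k) M1)).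

(* The cluster algebra of S0, with variables labeled through x, is the special
   cluster algebra A_o of type B_n attached to the (2n+2)-gon. *)
Record is_Acirc (S0 : seed n.+1 n F) (x : chord n -> F) : Prop := IsAcirc {
  Acirc_seed : is_seed kappa S0;
  Acirc_typeB : of_typeB kappa S0;
  Acirc_side : forall d, is_side d -> x d = 1;
  Acirc_theta : forall d, is_diag d -> x (theta d) = x d;
  Acirc_inj : forall d e, is_diag d -> is_diag e ->
    x d = x e -> e = d \/ e = theta d;
  Acirc_variables : forall y : F,
    (exists2 S, reachable kappa S0 S & exists i, y = cluster S i) <->
    (exists2 d, is_diag d & y = x d);
  Acirc_cluster_triangulation : forall S, reachable kappa S0 S ->
    exists2 T : {set chord n}, theta_triangulation T &
      forall y, (exists i, y = cluster S i) <-> (exists2 d, d \in T & y = x d);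
  Acirc_triangulation_cluster : forall T : {set chord n},
    theta_triangulation T ->
    exists2 S, reachable kappa S0 S &
      forall y, (exists i, y = cluster S i) <-> (exists2 d, d \in T & y = x d);
  Acirc_exchange : forall S S' k,
    reachable kappa S0 S -> mutation kappa k S S' ->
    exists d d' M1 M2,
      exchange_data d d' M1 M2 /\ exchange_is x S k (cluster S' k) d d' M1 M2;
  Acirc_exchange_all : forall d d' M1 M2, exchange_data d d' M1 M2 ->
    exists S S' k,
      [/\ reachable kappa S0 S, mutation kappa k S S'
        & exchange_is x S k (cluster S' k) d d' M1 M2]
}.

(* the cluster variable x_d if d is a diagonal, the generator p_d of the
   coefficient semifield if d is a side *)
Definition labeled (x : chord n -> F) (d : chord n) : F :=
  if is_side d then tropF kappa (side_coef d) else x d.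

End Acirc.

(* the generic 2 x m matrix, over the polynomial ring in its 2m entries *)
Definition generic_mx (m : nat) : 'M[{mpoly int[2 * m]}]_(2, m) :=
  \matrix_(i, j) 'X_(mxvec_index i j).

Definition plucker m (a b : 'I_m) : {mpoly int[2 * m]} :=
  generic_mx m 0 a * generic_mx m 1 b - generic_mx m 0 b * generic_mx m 1 a.

Definition plucker_generator m (f : {mpoly int[2 * m]}) : Prop :=
  exists a b : 'I_m, (a < b)%N /\ f = plucker a b.

Definition ZX (m : nat) : comNzRingType := gen_subring (@plucker_generator m).

(* The index a <= n+1 as an index of the matrix with n+2 columns; the column
   n+2 is ord_max. *)
Definition plucker_col n (a : 'I_n.+1) : 'I_n.+2 := widen_ord (leqnSn n.+1) a.

(* The element labeled by d is required to lie in the cluster algebra. *)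
Definition sends n (F : fieldType) (kappa : {rmorphism fracZP n.+1 -> F})
    (S0 : seed n.+1 n F) (x : chord n -> F)
    (phi : cluster_algebra kappa S0 -> ZX n.+2)
    (d : chord n) (f : {mpoly int[2 * n.+2]}) : Prop :=
  exists2 u : cluster_algebra kappa S0,
    val u = labeled kappa x d & val (phi u) = f.

Definition extends_correspondence n (F : fieldType)
    (kappa : {rmorphism fracZP n.+1 -> F})
    (S0 : seed n.+1 n F) (x : chord n -> F)
    (phi : cluster_algebra kappa S0 -> ZX n.+2) : Prop :=
  [/\ (forall a : 'I_n.+1,
         sends x phi [set vtx a; antip (vtx a)] (plucker (plucker_col a) ord_max)),
      (forall a b : 'I_n.+1, (a < b)%N ->
         sends x phi [set vtx a; vtx b] (plucker (plucker_col a) (plucker_col b)))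
    & (forall a b : 'I_n.+1, (a < b)%N ->
         sends x phi [set vtx a; antip (vtx b)]
           (plucker (plucker_col a) ord_max * plucker (plucker_col b) ord_max
            - plucker (plucker_col a) (plucker_col b)))].

(* Main.v *)
Require Import Defs.
From HB Require Import structures.
From mathcomp Require Import all_boot all_order all_fingroup all_algebra.
From mathcomp Require Import fraction.
From mathcomp.multinomials Require Import mpoly.
From mathcomp.classical Require Import boolp.
From mathcomp Require Import zify ring.

Set Implicit Arguments.
Unset Strict Implicit.
Unset Printing Implicit Defensive.

Import Order.TTheory GRing.Theory Num.Theory.
Local Open Scope ring_scope.

(** The special cluster algebra of type B has as many algebraically independent
    elements as the coordinate ring of the cone over the Grassmannian has
    dimension, namely 2n+1, and the isomorphism is obtained by exhibiting both
    rings inside the ambient field F.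

    Write X_d for the cluster variable, or the coefficient generator, labeled by
    the chord d, and X_a for the one of the diameter [a, a-bar].  Put into F the
    matrix with n+2 columns whose a-th column is (X_a, X_0a / X_0), with X_00 = 0,
    and whose last column is (0, 1).  Its minors are X_a for the columns a, n+2, and
    (X_a X_0b - X_b X_0a) / X_0 for the columns a < b.  The latter is X_ab: the
    relations [Exchange3] express X_(a, b-bar) as X_a X_b - X_ab, and after this
    substitution the relation [Exchange2] becomes X_a times the Plücker relation
    X_ac X_b = X_ab X_c + X_a X_bc ([labeled_plucker]).  So specializing the
    generic matrix to this one gives a ring morphism [to_F] that sends the listed
    elements of the Plücker ring to the elements of F with the same labels, and
    maps that ring onto the cluster algebra, because every chord is listed up to the
    rotation Theta and every coefficient is a product of generators p_j.

    Dividing by X_a requires X_a <> 0 ([exchanged_variables_neq0]): if a mutation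
    starts from a variable equal to 0, then the right-hand side of the exchange
    relation vanishes and the new variable may be any element of F; but F is
    infinite while the cluster variables are labeled by finitely many diagonals.

    Injectivity of [to_F] is a matter of transcendence degree.  An element of the
    Plücker ring is determined by its value on the normal form of a matrix, which
    has 2n+1 free entries ([normal_mx_faithful]), so it is enough that the 2n+1
    entries X_a, X_0b / X_0 be algebraically independent.  The n+1 coefficient
    generators and the n variables of the initial seed are algebraically
    independent, and they are polynomials in these entries.  The counting argument
    of [alg_independent_of_polynomials] concludes: as many algebraically
    independent elements cannot be found among the polynomials in 2n+1 elements
    that satisfy a relation.

    With [to_F] injective, its inverse is the required isomorphism, and
    uniqueness holds because the labeled elements generate the cluster algebra. *)

(** * Subrings given by generators *)

Lemma in_gen_subring_gen (R : comNzRingType) (G : R -> Prop) g :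
  G g -> g \in in_gen_subring G.
Proof. by move=> Gg; apply/asboolP => S _; apply. Qed.

Lemma gen_subring_sub (R : comNzRingType) (G : R -> Prop) (S : R -> Prop) :
  S 1 -> (forall x y, S x -> S y -> S (x - y)) ->
  (forall x y, S x -> S y -> S (x * y)) ->
  (forall g, G g -> S g) -> forall y, y \in in_gen_subring G -> S y.
Proof.
move=> S1 SB SM SG y /asboolP/(_ (fun z => `[< S z >])) h.
apply/asboolP; apply: h => [|g /SG Sg]; last exact/asboolP.
by split=> [|u v /asboolP Su /asboolP Sv|u v /asboolP Su /asboolP Sv];
  apply/asboolP => //; [apply: SB | apply: SM].
Qed.

(** A morphism of the big rings that is injective on the first subring and matches
    the generators is inverted by choosing preimages; injectivity turns the choice
    function into a morphism. *)
Lemma gen_subring_iso (R1 R2 : comNzRingType) (G1 : R1 -> Prop) (G2 : R2 -> Prop)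
    (g : {rmorphism R1 -> R2}) :
  (forall f, f \in in_gen_subring G1 -> g f = 0 -> f = 0) ->
  (forall f, G1 f -> g f \in in_gen_subring G2) ->
  (forall y, G2 y -> exists2 f, f \in in_gen_subring G1 & g f = y) ->
  exists2 phi : {rmorphism gen_subring G2 -> gen_subring G1},
    bijective phi & forall u, g (val (phi u)) = val u.
Proof.
move=> g_inj gG1 gG2.
have gS (v : gen_subring G1) : g (val v) \in in_gen_subring G2.
  apply: (@gen_subring_sub _ G1 (fun f => g f \in in_gen_subring G2)) (valP v).
  - by rewrite rmorph1 rpred1.
  - by move=> a b ga gb; rewrite rmorphB rpredB.
  - by move=> a b ga gb; rewrite rmorphM rpredM.
  - exact: gG1.
have preim (u : gen_subring G2) : exists v : gen_subring G1, g (val v) = val u.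
  suff [f fS gf] : exists2 f, f \in in_gen_subring G1 & g f = val u.
    by exists (GenSubring fS).
  apply: (@gen_subring_sub _ G2
    (fun y => exists2 f, f \in in_gen_subring G1 & g f = y)) (valP u).
  - by exists 1; rewrite ?rpred1 ?rmorph1.
  - by move=> _ _ [a aS <-] [b bS <-]; exists (a - b); rewrite ?rpredB ?rmorphB.
  - by move=> _ _ [a aS <-] [b bS <-]; exists (a * b); rewrite ?rpredM ?rmorphM.
  - exact: gG2.
have [phi phiE] := choice preim.
have val_g_inj (v w : gen_subring G1) : g (val v) = g (val w) -> v = w.
  move=> /eqP; rewrite -subr_eq0 -rmorphB => /eqP/g_inj/eqP.
  by rewrite subr_eq0 rpredB ?(valP v) ?(valP w) // => /(_ isT)/eqP/val_inj.
have phiB : zmod_morphism phi.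
  by move=> u v; apply: val_g_inj; rewrite phiE !rmorphB /= !phiE.
have phiM : monoid_morphism phi.
  split=> [|u v]; apply: val_g_inj; first by rewrite phiE !rmorph1.
  by rewrite phiE !rmorphM /= !phiE.
pose fB := GRing.isZmodMorphism.Build _ _ phi phiB.
pose fM := GRing.isMonoidMorphism.Build _ _ phi phiM.
pose phiR : {rmorphism gen_subring G2 -> gen_subring G1} := HB.pack phi fB fM.
exists phiR; last exact: phiE.
exists (fun v => GenSubring (gS v)) => [u|v].
  by apply: val_inj; rewrite /= phiE.
by apply: val_g_inj; rewrite /= phiE.
Qed.

(** * Algebraic independence by counting monomials *)

(** The kernel of the matrix over the rationals provides a relation, whose
    denominators are then cleared. *)
Lemma int_linear_dependence (I J : finType) (A : I -> J -> int) :
  (#|J| < #|I|)%N ->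
  exists2 v : I -> int, exists i, v i != 0 & forall j, \sum_i v i * A i j = 0.
Proof.
move=> ltJI.
pose M : 'M[rat]_(#|I|, #|J|) :=
  \matrix_(i, j) (A (enum_val i) (enum_val j))%:~R.
pose w := nz_row (kermx M).
have w_n0 : w != 0.
  rewrite nz_row_eq0 -mxrank_eq0 mxrank_ker subn_eq0 -ltnNge.
  exact: leq_ltn_trans (rank_leq_col M) ltJI.
have wM : w *m M = 0 by apply/sub_kermxP; exact: nz_row_sub.
have [i0 wi0] := rV0Pn _ w_n0.
pose d := \prod_i denq (w 0 i).
have d_n0 : d != 0 by apply/prodf_neq0 => i _; exact: denq_neq0.
pose v i := numq (w 0 (enum_rank i)) *
            \prod_(j | j != enum_rank i) denq (w 0 j).
have vE i : (v i)%:~R = d%:~R * w 0 (enum_rank i) :> rat.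
  have -> : d = denq (w 0 (enum_rank i)) *
      \prod_(j | j != enum_rank i) denq (w 0 j).
    by rewrite /d [LHS](bigD1 (enum_rank i)).
  by rewrite /v !intrM numqE -[LHS]mulrA [LHS]mulrC.
exists v.
  exists (enum_val i0); rewrite -(intr_eq0 rat) vE enum_valK mulf_neq0 //.
  by rewrite intr_eq0.
move=> j; apply: (@intr_inj rat); rewrite rmorph_sum /=.
transitivity (d%:~R * (w *m M) 0 (enum_rank j)).
  rewrite mxE mulr_sumr (reindex (@enum_val I predT)) /=; last first.
    by exists enum_rank => i _; rewrite ?enum_rankK ?enum_valK.
  by apply: eq_bigr => i _; rewrite intrM vE enum_valK mxE enum_rankK mulrA.
by rewrite wM mxE mulr0.
Qed.

Lemma intr_mpolyC N (c : int) : c%:~R = c%:MP_[N] :> {mpoly int[N]}.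
Proof. by rewrite -[c in RHS]intz rmorph_int. Qed.

Lemma mpoly_int_morph_ext N (R : nzRingType)
    (f g : {rmorphism {mpoly int[N]} -> R}) :
  (forall i, f 'X_i = g 'X_i) -> f =1 g.
Proof.
move=> fg p; rewrite (mpolyE p) !rmorph_sum; apply: eq_bigr => m _.
rewrite -mul_mpolyC -intr_mpolyC !rmorphM !rmorph_int; congr (_ * _).
rewrite mpolyXE_id !rmorph_prod; apply: eq_bigr => i _.
by rewrite !rmorphXn fg.
Qed.

(** Bounding each exponent separately, rather than the total degree, makes the
    number of available monomials a plain power [(W + 1) ^ N]. *)
Definition box_supported N (W : nat) (f : {mpoly int[N]}) : Prop :=
  forall m, m \in msupp f -> forall i, (m i <= W)%N.

Lemma box_supported_exists N (f : {mpoly int[N]}) :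
  exists W, box_supported W f.
Proof.
exists (msize f) => m mf i; apply: leq_trans (ltnW (msize_mdeg_lt mf)).
by rewrite mdegE (bigD1 i) //= leq_addr.
Qed.

Lemma box_supported_le N W W' (f : {mpoly int[N]}) :
  (W <= W')%N -> box_supported W f -> box_supported W' f.
Proof. by move=> leW fW m mf i; apply: leq_trans leW; apply: fW. Qed.

Lemma box_supportedM N W W' (f g : {mpoly int[N]}) :
  box_supported W f -> box_supported W' g -> box_supported (W + W') (f * g).
Proof.
move=> fW gW m /msuppM_le/allpairsP[[m1 m2] /= [m1f m2g ->]] i.
by rewrite mnmDE leq_add ?fW ?gW.
Qed.

Lemma box_supportedX N W (f : {mpoly int[N]}) k :
  box_supported W f -> box_supported (W * k) (f ^+ k).
Proof.
move=> fW; elim: k => [|k IHk]; last by rewrite exprS mulnS; apply: box_supportedM.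
by move=> m; rewrite expr0 msupp1 inE => /eqP-> i; rewrite mnm0E.
Qed.

Lemma box_supported_prod N W k (f : 'I_k -> {mpoly int[N]}) :
  (forall i, box_supported W (f i)) ->
  box_supported (k * W) (\prod_(i < k) f i).
Proof.
elim: k f => [|k IHk] f fW.
  by rewrite big_ord0 => m; rewrite msupp1 inE => /eqP-> i; rewrite mnm0E.
by rewrite big_ord_recl mulSn; apply: box_supportedM => //; apply: IHk.
Qed.

(** A polynomial of degree N in W changes by O(W^(N-1)) under a bounded shift. *)
Lemma expn_sub_bound W e N :
  (e <= W)%N -> (W ^ N <= (W - e) ^ N + N * e * W ^ N.-1)%N.
Proof.
move=> leeW; elim: N => [|N IHN] //.
have h1 : (W ^ N.+1 <= (W - e) * (W - e) ^ N + e * (W - e) ^ N + N * e * W ^ N)%N.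
  rewrite -mulnDl subnK // expnS.
  apply: leq_trans (leq_mul (leqnn W) IHN) _; rewrite mulnDr leq_add2l.
  case: N {IHN} => [|N]; first by rewrite !mul0n muln0.
  by rewrite /= [(W ^ N.+1)%N]expnS; nia.
have h2 : (e * (W - e) ^ N <= e * W ^ N)%N.
  rewrite leq_mul2l; apply/orP; right.
  by case: (N) => // k; rewrite leq_exp2r // leq_subr.
by rewrite /= [((W - e) ^ N.+1)%N]expnS; nia.
Qed.

Definition box_mnm N W (a : {ffun 'I_N -> 'I_W}) : 'X_{1..N} :=
  [multinom (a i : nat) | i < N].

Lemma poly_eq0_of_box N W (f : {mpoly int[N]}) :
  box_supported W f ->
  (forall a : {ffun 'I_N -> 'I_W.+1}, f@_(box_mnm a) = 0) -> f = 0.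
Proof.
move=> fW f0; apply/mpolyP => m; rewrite mcoeff0; apply/eqP.
rewrite mcoeff_eq0; apply/negP => mf.
have := mf; rewrite mcoeff_msupp; case/negP; apply/eqP.
rewrite -(f0 [ffun i => inord (m i)]); congr mcoeff.
by apply/mnmP => i; rewrite /box_mnm mnmE ffunE inordK // ltnS fW.
Qed.

Lemma box_mnm_inj N W :
  injective (@box_mnm N W).
Proof.
move=> a b /mnmP ab; apply/ffunP => i; apply: val_inj.
by have := ab i; rewrite !mnmE.
Qed.

Lemma mcoeff_sum_monomials N W (v : {ffun 'I_N -> 'I_W} -> int) b :
  (\sum_a v a *: 'X_[box_mnm a])
    @_(box_mnm b) = v b.
Proof.
rewrite raddf_sum /= (bigD1 b) //= mcoeffZ mcoeffX eqxx mulr1 big1 ?addr0 //.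
move=> a /negPf ab; rewrite mcoeffZ mcoeffX (inj_eq (@box_mnm_inj N W)).
by rewrite ab mulr0.
Qed.

(** If Q is a nonzero relation between the y_i, then the products s^a with all
    a_i < D, lifted to polynomials in the y_i, and the multiples Q * y^b are
    linearly independent: evaluation at y kills the latter and separates the
    former.  All of them live in a box of side W + 1 = C * D with C fixed.  If e
    bounds the exponents of Q, the multiples of Q already span all but O(D^(N-1))
    of the dimensions of that box, which leaves no room for the D^N products s^a
    when D is large. *)
Lemma alg_independent_of_polynomials N (R : idomainType) (y s : 'I_N -> R)
    (sig : 'I_N -> {mpoly int[N]}) :
  (forall i, mmap intr y (sig i) = s i) ->
  (forall f : {mpoly int[N]}, mmap intr s f = 0 -> f = 0) ->
  forall f : {mpoly int[N]}, mmap intr y f = 0 -> f = 0.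
Proof.
move=> sigE s_free Q Q0; apply/eqP/negPn/negP => Q_n0.
have [e Qe] := box_supported_exists Q.
have [c sigc] : exists c, forall i, box_supported c (sig i).
  have [c cP] := choice (fun i => box_supported_exists (sig i)).
  exists (\max_i c i) => i; apply: box_supported_le (cP i).
  exact: (leq_bigmax i).
(* The products s^a reach exponents N * c * (D - 1), and C exceeds N * c by enough
   for the box to contain Q as well. *)
pose C := (N * c + e).+1.
(* D0 is chosen so that D^N > N * e * (C * D)^(N-1) for D = D0 + 1. *)
have [D0 D0E] : exists D0, D0 = (N * e * C ^ N.-1)%N by eexists.
pose D := D0.+1.
have [W WE] : exists W, W.+1 = (C * D)%N
  by exists (C * D).-1; rewrite prednK ?muln_gt0.
have leNcW : (N * (c * D0) <= W)%N by rewrite -ltnS WE /C /D; nia.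
have leeW : (e <= W)%N by rewrite -ltnS WE /C /D; nia.
pose b := (W.+1 - e)%N.
pose T (a : {ffun 'I_N -> 'I_D}) := mmap intr sig 'X_[box_mnm a].
pose U (a : {ffun 'I_N -> 'I_b}) := Q * 'X_[box_mnm a].
pose rowp (r : {ffun 'I_N -> 'I_D} + {ffun 'I_N -> 'I_b}) :=
  match r with inl a => T a | inr a => U a end.
have rowW r : box_supported W (rowp r).
  case: r => a /=.
    rewrite /T mmapX /mmap1; apply: (box_supported_le leNcW).
    apply: box_supported_prod => i.
    refine (box_supported_le _ (box_supportedX (sigc i))).
    by rewrite leq_mul2l /box_mnm mnmE -ltnS ltn_ord orbT.
  refine (@box_supported_le _ (e + b.-1) _ _ _ _); first by rewrite /b; lia.
  apply: box_supportedM => // m; rewrite msuppX inE => /eqP-> i.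
  by rewrite /box_mnm mnmE; case: (a i) => k /=; lia.
have [|v [r0 vr0] v_ker] := int_linear_dependence
   (fun r (a : {ffun 'I_N -> 'I_W.+1}) => (rowp r)@_(box_mnm a)).
  rewrite card_sum !card_ffun !card_ord.
  apply: leq_ltn_trans (expn_sub_bound N (leqW leeW)) _.
  rewrite addnC ltn_add2r; have [N0|N_gt0] := posnP N.
    by rewrite [X in (X * e)%N]N0 expn_gt0.
  rewrite WE expnMn mulnA -D0E -[X in (_ < D ^ X)%N](prednK N_gt0) expnS.
  by rewrite ltn_pmul2r ?expn_gt0.
pose fA := \sum_a v (inl a) *: 'X_[box_mnm a] : {mpoly int[N]}.
pose h := \sum_a v (inr a) *: 'X_[box_mnm a] : {mpoly int[N]}.
have rel : mmap intr sig fA + Q * h = 0.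
  have -> : mmap intr sig fA + Q * h = \sum_r v r *: rowp r.
    rewrite big_sumType /= /fA /h mulr_sumr !rmorph_sum /=; congr (_ + _).
      by apply: eq_bigr => a _; rewrite mmapZ /= intr_mpolyC mul_mpolyC.
    by apply: eq_bigr => a _; rewrite scalerAr.
  apply: (@poly_eq0_of_box _ W) => [m|a]; last first.
    by rewrite raddf_sum -[RHS](v_ker a); apply: eq_bigr => r _; rewrite /= mcoeffZ.
  rewrite mcoeff_msupp raddf_sum /= => nz i; rewrite leqNgt; apply/negP => ltWm.
  case/negP: nz; rewrite big1 // => r _; rewrite mcoeffZ.
  have [mr|] := boolP (m \in msupp (rowp r)); last first.
    by move/memN_msupp_eq0->; rewrite mulr0.
  by have := rowW r m mr i; rewrite leqNgt ltWm.
have fA0 : fA = 0.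
  apply: s_free; transitivity (mmap intr y (mmap intr sig fA)).
    symmetry; apply: (@mpoly_int_morph_ext _ _ (mmap intr y \o mmap intr sig)
                                               (mmap intr s)).
    by move=> i; rewrite /= !mmapX !mmap1U sigE.
  move/(congr1 (mmap intr y)): rel.
  by rewrite rmorphD rmorphM /= Q0 mul0r addr0 rmorph0.
have h0 : h = 0.
  by move/eqP: rel; rewrite fA0 rmorph0 add0r mulf_eq0 (negPf Q_n0) => /eqP.
case/eqP: vr0; case: r0 => a.
  by rewrite -(mcoeff_sum_monomials (fun a => v (inl a))) -/fA fA0 mcoeff0.
by rewrite -(mcoeff_sum_monomials (fun a => v (inr a))) -/h h0 mcoeff0.
Qed.

(** * The Plücker ring and the normal form of a matrix *)

Local Notation eval_mx M := (mmap intr (fun k => mxvec M 0 k)).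

Lemma eval_mx_plucker (R : comNzRingType) m (M : 'M[R]_(2, m)) a b :
  eval_mx M (plucker a b) = M 0 a * M 1 b - M 0 b * M 1 a.
Proof.
by rewrite rmorphB !rmorphM /= !mxE !mmapX !mmap1U !mxvecE.
Qed.

(** Up to the action of SL_2 a generic matrix has last column (0, 1). *)
Definition normal_mx n (R : comNzRingType) (u w : 'I_n.+1 -> R) :
    'M[R]_(2, n.+2) :=
  \matrix_(i, j) if unlift ord_max j is Some a then if i == 0 then u a else w a
                 else (i != 0)%:R.

Lemma plucker_colE n (a : 'I_n.+1) : plucker_col a = lift ord_max a.
Proof. by apply: val_inj; rewrite /= /bump leqNgt ltn_ord. Qed.

Lemma plucker_col_lt n (a b : 'I_n.+2) : (a < b)%N ->
  exists2 a', a = plucker_col a' &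
    b = ord_max \/ exists2 b', b = plucker_col b' & (a' < b')%N.
Proof.
case: (unliftP ord_max a) => [a' ->|->]; last first.
  by rewrite ltnNge -ltnS ltn_ord.
rewrite -plucker_colE => ltab; exists a' => //.
case: (unliftP ord_max b) ltab => [b' ->|->]; last by left.
by rewrite -plucker_colE => ltab; right; exists b'.
Qed.

Section NormalMx.
Variables (n : nat) (R : comNzRingType) (u w : 'I_n.+1 -> R).

Lemma normal_mx_plucker a b :
  eval_mx (normal_mx u w) (plucker (plucker_col a) (plucker_col b)) =
  u a * w b - u b * w a.
Proof. by rewrite eval_mx_plucker !plucker_colE !mxE !liftK. Qed.

Lemma normal_mx_plucker_max a :
  eval_mx (normal_mx u w) (plucker (plucker_col a) ord_max) = u a.
Proof.
by rewrite eval_mx_plucker plucker_colE !mxE liftK unlift_none mulr1 mul0r subr0.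
Qed.
End NormalMx.

(** This element and the next two are nonzero because each takes a nonzero value at
    a suitable integer matrix. *)
Lemma plucker_max_neq0 n (a : 'I_n.+1) : plucker (plucker_col a) ord_max != 0.
Proof.
apply/eqP => /(congr1 (eval_mx (normal_mx (fun=> 1) (fun=> 0) : 'M[int]_(2, n.+2)))).
by rewrite normal_mx_plucker_max rmorph0.
Qed.

Lemma plucker_neq0 n (a b : 'I_n.+1) : (a < b)%N ->
  plucker (plucker_col a) (plucker_col b) != 0.
Proof.
move=> ltab; apply/eqP.
move=> /(congr1 (eval_mx (normal_mx (fun=> 1) (fun c => c%:Z)))).
by rewrite normal_mx_plucker rmorph0; lia.
Qed.

Lemma plucker_bar_neq0 n (a b : 'I_n.+1) :
  plucker (plucker_col a) ord_max * plucker (plucker_col b) ord_max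
  - plucker (plucker_col a) (plucker_col b) != 0.
Proof.
apply/eqP => /(congr1 (eval_mx (normal_mx (fun=> 1 : int) (fun=> 0)))).
by rewrite rmorphB rmorphM /= normal_mx_plucker !normal_mx_plucker_max rmorph0.
Qed.

(** The remaining freedom of SL_2 makes the second entry of column 0 vanish; the
    other 2n+1 entries of the first n+1 columns are the coordinates y. *)
Definition row1_of n (R : Type) (y : 'I_(n.+1 + n) -> R) (a : 'I_n.+1) : R :=
  y (lshift n a).
Definition row2_of n (R : comNzRingType) (y : 'I_(n.+1 + n) -> R)
    (a : 'I_n.+1) : R :=
  if unlift ord0 a is Some b then y (rshift n.+1 b) else 0.

Lemma eval_normal_mx_comp n (R : comNzRingType) (y : 'I_(n.+1 + n) -> R) f :
  eval_mx (normal_mx (row1_of y) (row2_of y)) f =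
  mmap intr y (eval_mx (normal_mx (row1_of (fun i => 'X_i : {mpoly int[n.+1 + n]}))
                                  (row2_of (fun i => 'X_i))) f).
Proof.
pose g := eval_mx (normal_mx (row1_of (fun i => 'X_i : {mpoly int[n.+1 + n]}))
                                  (row2_of (fun i => 'X_i))).
rewrite -/(g f).
apply: (@mpoly_int_morph_ext _ _ (eval_mx _) (mmap intr y \o g)) => k.
case/mxvec_indexP: k => i j.
rewrite /= /g !mmapX !mmap1U !mxvecE !mxE /row1_of /row2_of.
case: (unlift _ _) => [a|]; last by rewrite rmorph_nat.
case: (i == 0); first by rewrite mmapX mmap1U.
by case: (unlift _ _) => [b|]; rewrite ?mmapX ?mmap1U ?rmorph0.
Qed.

(** Over the fraction field the generic matrix has the same minors as a matrix in
    normal form, with first row [Delta_(a,n+2)] and second row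
    [Delta_(0,a) / Delta_(0,n+2)]; this is the Plücker relation.  Hence an element
    of the Plücker ring is recovered from its value on normal forms. *)
Lemma normal_mx_faithful n f : f \in in_gen_subring (@plucker_generator n.+2) ->
  eval_mx (normal_mx (row1_of (fun i => 'X_i : {mpoly int[n.+1 + n]}))
                     (row2_of (fun i => 'X_i))) f = 0 -> f = 0.
Proof.
move=> fS f0; apply/eqP; rewrite -tofrac_eq0.
pose D0 a : {mpoly int[2 * n.+2]} := plucker (plucker_col ord0) (plucker_col a).
pose DM a : {mpoly int[2 * n.+2]} := plucker (plucker_col a) ord_max.
pose y (i : 'I_(n.+1 + n)) : {fraction {mpoly int[2 * n.+2]}} :=
  match split i with
  | inl a => tofrac (DM a)
  | inr b => tofrac (D0 (lift ord0 b)) / tofrac (DM ord0)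
  end.
have y1 a : row1_of y a = tofrac (DM a).
  by rewrite /row1_of /y (unsplitK (inl _ a)).
have y2 a : row2_of y a = tofrac (D0 a) / tofrac (DM ord0).
  rewrite /row2_of; case: (unliftP ord0 a) => [b ->|->].
    by rewrite /y (unsplitK (inr _ b)).
  by rewrite /D0 /plucker subrr tofrac0 mul0r.
suff -> : tofrac f = eval_mx (normal_mx (row1_of y) (row2_of y)) f.
  by rewrite eval_normal_mx_comp f0 rmorph0.
have DM0 : tofrac (DM ord0) != 0 by rewrite tofrac_eq0 plucker_max_neq0.
apply: (@gen_subring_sub _ _
  (fun h => tofrac h = eval_mx (normal_mx (row1_of y) (row2_of y)) h)) fS.
- by rewrite !rmorph1.
- by move=> g h gE hE; rewrite !rmorphB /= gE hE.
- by move=> g h gE hE; rewrite !rmorphM /= gE hE.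
move=> _ [a [b [/plucker_col_lt[a' -> [->|[b' -> _]]] ->]]].
  by rewrite normal_mx_plucker_max y1.
rewrite normal_mx_plucker !y1 !y2.
apply: (mulIf DM0); rewrite mulrBl -!mulrA !mulVf // !mulr1.
rewrite -!rmorphM -rmorphB /=; congr tofrac; rewrite /DM /D0 /plucker; ring.
Qed.

(** * Chords of the polygon *)

Section Polygon.
Variable n : nat.
Implicit Types (a b c : 'I_n.+1) (v : vertex n) (d : chord n).

Lemma val_natv k : ((k%:R : vertex n) : nat) = (k %% n.*2.+2)%N.
Proof. by rewrite Zp_nat. Qed.

Lemma natv_eq i j : (i < n.*2.+2)%N -> (j < n.*2.+2)%N ->
  (i%:R == j%:R :> vertex n) = (i == j).
Proof. by move=> li lj; rewrite -val_eqE /= !val_natv !modn_small. Qed.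

Lemma natv_period k : (k + n.*2.+2)%:R = k%:R :> vertex n.
Proof. by apply: val_inj; rewrite /= !val_natv modnDr. Qed.

Lemma vtxE a : vtx a = (a : nat)%:R.
Proof.
apply: val_inj; rewrite /= val_natv inordK; last by have := ltn_ord a; lia.
by rewrite modn_small //; have := ltn_ord a; lia.
Qed.

Lemma antip_natv k : antip (k%:R : vertex n) = (k + n.+1)%:R.
Proof. exact: esym (natrD _ _ _). Qed.

Lemma antipK : involutive (@antip n).
Proof.
move=> v; rewrite -(natr_Zp v) !antip_natv -addnA.
have -> : (n.+1 + n.+1 = n.*2.+2)%N by lia.
exact: natv_period.
Qed.

Lemma vertexP v : exists a, v = vtx a \/ v = antip (vtx a).
Proof.
have lv := ltn_ord v; have [lvn|ltnv] := leqP v n.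
  by exists (inord v); left; rewrite vtxE inordK ?ltnS // natr_Zp.
exists (inord (v - n.+1)); right; rewrite vtxE inordK; last by lia.
by rewrite antip_natv subnK // natr_Zp.
Qed.

Lemma theta_set2 (u v : vertex n) :
  theta [set u; v] = [set antip u; antip v].
Proof. by rewrite /theta imsetU !imset_set1. Qed.

Lemma thetaK : involutive (@theta n).
Proof.
move=> d; rewrite /theta -imset_comp -[RHS]imset_id.
by apply: eq_imset => v /=; rewrite antipK.
Qed.

Lemma card_theta d : #|theta d| = #|d|.
Proof. by rewrite card_imset //; apply: (can_inj antipK). Qed.

Lemma is_side_theta d : is_side (theta d) = is_side d.
Proof.
have sub (e : chord n) : is_side e -> is_side (theta e).
  move=> /existsP[a /eqP->]; apply/existsP; exists (antip a).
  by rewrite theta_set2 /antip addrAC.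
by apply/idP/idP => [/sub|/sub //]; rewrite thetaK.
Qed.

Lemma side_orbit_theta d (j : 'I_n.+1) :
  (theta d \in side_orbit j) = (d \in side_orbit j).
Proof.
rewrite /side_orbit !in_set2 orbC; congr (_ || _).
  exact: (inj_eq (can_inj thetaK)).
exact: (can2_eq thetaK thetaK).
Qed.

Lemma side_coef_theta d : side_coef (theta d) = side_coef d.
Proof. by apply/ffunP => j; rewrite !ffunE side_orbit_theta. Qed.

Lemma side_coef_nonside d : ~~ is_side d -> side_coef d = 0.
Proof.
move=> d_nside; apply/ffunP => j; rewrite !ffunE.
case: (boolP (d \in side_orbit j)) => // dj.
have sj : is_side [set vtx j; vtx j + 1] by apply/existsP; exists (vtx j).
case/negP: d_nside; move: dj; rewrite /side_orbit in_set2 => /orP[]/eqP-> //.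
by rewrite is_side_theta.
Qed.

Lemma set2_eq (T : finType) (x y z t : T) : [set x; y] = [set z; t] ->
  (x = z /\ y = t) \/ (x = t /\ y = z).
Proof.
move=> E; have : x \in [set z; t] by rewrite -E set21.
have : y \in [set z; t] by rewrite -E set22.
have : z \in [set x; y] by rewrite E set21.
have : t \in [set x; y] by rewrite E set22.
by rewrite !in_set2; do 4![case/orP=> /eqP ?]; subst; auto.
Qed.

Lemma chord_natv_side i j : (i < j)%N -> (j < n.*2.+2)%N ->
  is_side [set i%:R; j%:R : vertex n] = (j == i.+1) || (i == 0%N) && (j == n.*2.+1).
Proof.
move=> ltij ltj; apply/idP/idP.
  move=> /existsP[v /eqP].
  rewrite -(natr_Zp v) natr1 => /set2_eq; have lv := ltn_ord v.
  have [ltv|/eqP eqv] : (v.+1 < n.*2.+2)%N \/ v.+1 == n.*2.+2 by lia.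
    by case=> -[/eqP + /eqP]; rewrite !natv_eq; lia.
  have -> : v.+1%:R = 0%:R :> vertex n by rewrite eqv -(natv_period 0).
  by case=> -[/eqP + /eqP]; rewrite !natv_eq; lia.
case/orP=> [/eqP->|/andP[/eqP-> /eqP->]]; apply/existsP.
  by exists i%:R; rewrite natr1.
exists (n.*2.+1)%:R; rewrite natr1 setUC.
by have -> : (n.*2.+2)%:R = 0%:R :> vertex n by rewrite -(natv_period 0).
Qed.

Lemma chord_natv_diag i j : (i < j)%N -> (j < n.*2.+2)%N ->
  is_diag [set i%:R; j%:R : vertex n] =
  (j != i.+1) && ((i != 0%N) || (j != n.*2.+1)).
Proof.
move=> ltij ltj; rewrite /is_diag chord_natv_side // cards2 natv_eq //; last by lia.
by rewrite negb_or negb_and; have -> : i != j by lia.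
Qed.

Lemma side_coef_vtx (j : 'I_n.+1) : (0 < n)%N ->
  side_coef [set vtx j; vtx j + 1] = [ffun k => (k == j)%:R].
Proof.
move=> n_gt0; apply/ffunP => k; rewrite !ffunE /side_orbit in_set2.
have lj := ltn_ord j; have lk := ltn_ord k.
have -> : (k == j) = (k == j :> nat) by [].
rewrite theta_set2 !vtxE !natr1 !antip_natv.
case: (k =P j :> nat) => [->|/eqP nkj]; first by rewrite eqxx.
case: eqP => [/set2_eq|_] /=.
  by case=> -[/eqP + /eqP]; rewrite !natv_eq; lia.
case: eqP => [/set2_eq|_] //=.
have [ltk|/eqP eqk] : (k.+1 + n.+1 < n.*2.+2)%N \/ (k.+1 + n.+1 == n.*2.+2)%N by lia.
  by case=> -[/eqP + /eqP]; rewrite !natv_eq; lia.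
have -> : (k.+1 + n.+1)%:R = 0%:R :> vertex n by rewrite eqk -(natv_period 0).
by case=> -[/eqP + /eqP]; rewrite !natv_eq; lia.
Qed.

(** The chords for which the correspondence with the Plücker ring is prescribed. *)
Inductive listed_chord : chord n -> Prop :=
| ListedDiameter a : listed_chord [set vtx a; antip (vtx a)]
| ListedSame a b of (a < b)%N : listed_chord [set vtx a; vtx b]
| ListedOpposite a b of (a < b)%N : listed_chord [set vtx a; antip (vtx b)].

Lemma chord_listed d : #|d| = 2%N -> listed_chord d \/ listed_chord (theta d).
Proof.
move=> /eqP/cards2P[u [v [uv ->]]].
have two a b : vtx a != vtx b -> listed_chord [set vtx a; vtx b].
  case: (ltngtP a b) => [ltab _|ltab _|/val_inj->]; last by rewrite eqxx.
    exact: ListedSame.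
  by rewrite setUC; apply: ListedSame.
have mixed a b : listed_chord [set vtx a; antip (vtx b)] \/
                 listed_chord [set antip (vtx a); vtx b].
  case: (ltngtP a b) => [ltab|ltab|/val_inj->].
  - by left; apply: ListedOpposite.
  - by right; rewrite setUC; apply: ListedOpposite.
  - by left; apply: ListedDiameter.
rewrite theta_set2.
have [a uE] := vertexP u; have [b vE] := vertexP v.
case: uE uv => ->; case: vE => -> uv; rewrite ?antipK.
- by left; apply: two.
- by have := mixed a b; tauto.
- by have := mixed a b; tauto.
- by right; apply: two; rewrite -(inj_eq (can_inj antipK)).
Qed.

End Polygon.

(** * The exchange relations between listed chords *)

Lemma val_natvB n i j : (j <= i)%N -> (i < n.*2.+2)%N ->
  ((i%:R - j%:R : vertex n)%R : nat) = (i - j)%N.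
Proof.
move=> leji lti; have -> : i%:R - j%:R = (i - j)%:R :> vertex n.
  exact: esym (natrB _ leji).
by rewrite val_natv modn_small //; lia.
Qed.

Lemma diameter_exchange n (a b : 'I_n.+1) : (a < b)%N ->
  exchange_data [set vtx a; antip (vtx a)] [set vtx b; antip (vtx b)]
    [:: [set vtx a; vtx b]] [:: [set vtx a; antip (vtx b)]].
Proof.
move=> ltab; have lb := ltn_ord b; apply: Exchange3.
by rewrite /ccw !map_cons !vtxE antip_natv !val_natvB /=; lia.
Qed.

Lemma half_exchange n (a b c : 'I_n.+1) : (a < b)%N -> (b < c)%N ->
  exchange_data [set vtx a; vtx c] [set vtx a; antip (vtx b)]
    [:: [set vtx a; vtx b]; [set vtx a; antip (vtx c)]]
    [:: [set vtx a; antip (vtx a)]; [set vtx a; antip (vtx a)];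
        [set vtx b; vtx c]].
Proof.
move=> ltab ltbc; have lc := ltn_ord c; apply: Exchange2.
by rewrite /ccw !map_cons !vtxE antip_natv !val_natvB /=; lia.
Qed.

Lemma side_exchange n (v : vertex n) : (0 < n)%N ->
  exchange_data [set v; antip v] [set v + 1; antip (v + 1)]
    [:: [set v; v + 1]] [:: [set v; antip (v + 1)]].
Proof.
move=> n_gt0; apply: Exchange3.
rewrite /ccw !map_cons subrr /antip ![v + _]addrC !addrK.
rewrite val_natv modn_small /=; last by lia.
by rewrite modn_small; lia.
Qed.

Lemma chord_natv_eq n i j k l :
  (i < j)%N -> (j < n.*2.+2)%N -> (k < l)%N -> (l < n.*2.+2)%N ->
  ([set i%:R; j%:R : vertex n] == [set k%:R; l%:R]) = (i == k) && (j == l).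
Proof.
move=> ltij ltj ltkl ltl; apply/eqP/andP => [/set2_eq|[/eqP-> /eqP->] //].
by case=> -[/eqP + /eqP]; rewrite !natv_eq; lia.
Qed.

Lemma theta_diameter n (v : vertex n) : theta [set v; antip v] = [set v; antip v].
Proof. by rewrite theta_set2 antipK setUC. Qed.

Lemma card_side n (d : chord n) : is_side d -> #|d| = 2%N.
Proof.
case/existsP=> v /eqP->; rewrite cards2; apply/eqP; rewrite eqSS eqb1.
by rewrite -[X in X == _]addr0 (inj_eq (addrI v)) eq_sym oner_eq0.
Qed.

Lemma card_listed n (d : chord n) : listed_chord d -> #|d| = 2%N.
Proof.
by case=> [a|a b lab|a b lab]; rewrite cards2; apply/eqP; rewrite eqSS eqb1 !vtxE
  ?antip_natv natv_eq; have := ltn_ord a; try have := ltn_ord b; lia.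
Qed.

Lemma diameter_diag n (a : 'I_n.+1) : (0 < n)%N ->
  is_diag [set vtx a; antip (vtx a)].
Proof.
move=> n_gt0; have la := ltn_ord a.
by rewrite vtxE antip_natv chord_natv_diag; lia.
Qed.

(** * Coefficients and mutations *)

Section Coefficients.
Variables (m r : nat) (F : fieldType) (kappa : {rmorphism fracZP m -> F}).
Implicit Types (p q : trop m) (S : seed m r F).

Lemma kappa_poly_inj (f : {mpoly int[m]}) : kappa (tofrac f) = 0 -> f = 0.
Proof. by move/eqP; rewrite fmorph_eq0 tofrac_eq0 => /eqP. Qed.

Lemma natF_inj : injective (fun k : nat => k%:R : F).
Proof.
move=> i j /= eqij.
have : kappa (tofrac (i%:Z - j%:Z)%:MP) = 0 :> F.
  by rewrite -intr_mpolyC intrB !rmorphB !rmorph_nat eqij subrr.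
by move/kappa_poly_inj/eqP; rewrite mpolyC_eq0; lia.
Qed.

Lemma tropF0 : tropF kappa 0 = 1.
Proof. by rewrite /tropF big1 // => j _; rewrite ffunE expr0z. Qed.

Lemma tropFD p q : tropF kappa (p + q) = tropF kappa p * tropF kappa q.
Proof.
rewrite /tropF -big_split /=; apply: eq_bigr => j _; rewrite ffunE expfzDr //.
rewrite fmorph_eq0 tofrac_eq0; apply/eqP => /(congr1 (fun f => f@_U_(j)%MM)).
by rewrite mcoeffXU eqxx mcoeff0.
Qed.

Lemma tropF_sum (I : Type) (s : seq I) (p : I -> trop m) :
  tropF kappa (\sum_(i <- s) p i) = \prod_(i <- s) tropF kappa (p i).
Proof. exact: (big_morph _ tropFD tropF0). Qed.

Lemma tropF_delta (j : 'I_m) :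
  tropF kappa [ffun k => (k == j)%:R] = kappa (tofrac 'X_j).
Proof.
rewrite /tropF (bigD1 j) //= ffunE eqxx expr1z big1 ?mulr1 // => k /negPf kj.
by rewrite ffunE kj expr0z.
Qed.

(** Normalization determines both coefficients from their quotient, so two
    successive mutations in the same direction restore the exchange relation. *)
Lemma normalized_pair_unique p q p' q' :
  oplus p q = 0 -> oplus p' q' = 0 -> p' - q' = q - p -> p' = q /\ q' = p.
Proof.
move=> /ffunP pq /ffunP pq' /ffunP E.
have int_case (a b c d : int) : Num.min a b = 0 -> Num.min c d = 0 ->
    c - d = b - a -> c = b /\ d = a.
  by case: leP; case: leP; lia.
have H j : p' j = q j /\ q' j = p j.
  apply: int_case; [have := pq j | have := pq' j | have := E j];
    by rewrite !ffunE.
by split; apply/ffunP => j; have [] := H j.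
Qed.

Lemma normalized_pair_exists q : exists pq : trop m * trop m,
  oplus pq.1 pq.2 = 0 /\ pq.1 - pq.2 = q.
Proof.
have int_case (a : int) : Num.min (Num.max a 0) (Num.max (- a) 0) = 0 /\
    Num.max a 0 - Num.max (- a) 0 = a.
  by case: (leP a); case: (leP (- a)); case: leP; lia.
exists ([ffun j => Num.max (q j) 0], [ffun j => Num.max (- q j) 0]).
by split; apply/ffunP => j; rewrite !ffunE /=; case: (int_case (q j)).
Qed.

Definition exchange_rhs S k : F :=
  tropF kappa (coef_pos S k) *
    \prod_(i < r | 0 < exmx S i k) cluster S i ^ exmx S i k +
  tropF kappa (coef_neg S k) *
    \prod_(i < r | exmx S i k < 0) cluster S i ^ (- exmx S i k).

(** The data of a mutated seed other than the new variable are explicit, so a seed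
    mutates as soon as its exchange relation can be solved, and to any solution. *)
Lemma mutation_exists S k y :
  cluster S k * y = exchange_rhs S k ->
  exists2 S', mutation kappa k S S' & cluster S' k = y.
Proof.
move=> yE.
have [pq pqP] := choice (fun i => normalized_pair_exists
   (if i == k then coef_neg S k - coef_pos S k
    else (if 0 <= exmx S k i then coef_pos S k else coef_neg S k) *~ exmx S k i
         + (coef_pos S i - coef_neg S i))).
exists (Seed (fun i => if i == k then y else cluster S i)
  (fun i => (pq i).1) (fun i => (pq i).2) (mutate_mx k (exmx S))) => /=;
  last by rewrite eqxx.
split=> //=; first by move=> i /negPf->.
- by rewrite eqxx.
- by move=> i; case: (pqP i).
- by move=> i; case: (pqP i).
Qed.

Lemma exchange_rhs_factors S k :
  exchange_rhs S k =
  tropF kappa (coef_pos S k) * \prod_(y <- factorsp S k) y +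
  tropF kappa (coef_neg S k) * \prod_(y <- factorsm S k) y.
Proof.
have prodE (P : pred 'I_r) (e : 'I_r -> int) : (forall i, P i -> 0 <= e i) ->
    (forall i, `|e i|%N = `|exmx S i k|%N) ->
    \prod_(i < r | P i) cluster S i ^ e i =
    \prod_(y <- flatten [seq nseq `|exmx S i k| (cluster S i)
                        | i <- enum 'I_r & P i]) y.
  move=> e_ge0 eE; rewrite big_flatten big_map big_filter big_enum_cond /=.
  apply: eq_bigr => i Pi.
  by rewrite big_nseq iter_mulr mulr1 -eE -[in LHS](gez0_abs (e_ge0 i Pi)).
rewrite /exchange_rhs /factorsp /factorsm; congr (_ * _ + _ * _); apply: prodE => //.
- by move=> i /ltW.
- by move=> i; rewrite oppr_ge0 => /ltW.
- by move=> i; rewrite abszN.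
Qed.

Lemma exchange_rhs_mutation S S' k :
  normalized S -> mutation kappa k S S' -> exmx S k k = 0 ->
  exchange_rhs S' k = exchange_rhs S k.
Proof.
move=> nS [xE _ nS' cE BE] Bkk0.
have := cE k; rewrite eqxx => /(normalized_pair_unique (nS k) (nS' k))[pE qE].
rewrite /exchange_rhs pE qE [RHS]addrC BE; congr (_ * _ + _ * _).
  have bE i : mutate_mx k (exmx S) i k = - exmx S i k by rewrite mxE eqxx orbT.
  apply: eq_big => [i|i]; rewrite bE ?oppr_gt0 // => Bi.
  by rewrite xE //; apply: contraTneq Bi => ->; rewrite Bkk0.
have bE i : mutate_mx k (exmx S) i k = - exmx S i k by rewrite mxE eqxx orbT.
apply: eq_big => [i|i]; rewrite bE ?oppr_lt0 ?opprK // => Bi.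
by rewrite xE //; apply: contraTneq Bi => ->; rewrite Bkk0.
Qed.

Lemma mem_factors S k : exmx S k k != 0 ->
  cluster S k \in factorsp S k ++ factorsm S k.
Proof.
move=> Bkk; rewrite mem_cat; apply/orP.
have mem : cluster S k \in nseq `|exmx S k k| (cluster S k).
  by rewrite mem_nseq eqxx absz_gt0 Bkk.
have [Bpos|Bneg|B0] := ltgtP 0 (exmx S k k); last by rewrite -B0 eqxx in Bkk.
  left; apply/flattenP; exists (nseq `|exmx S k k| (cluster S k)) => //.
  by apply/mapP; exists k => //; rewrite mem_filter Bpos mem_enum.
right; apply/flattenP; exists (nseq `|exmx S k k| (cluster S k)) => //.
by apply/mapP; exists k => //; rewrite mem_filter Bneg mem_enum.
Qed.

End Coefficients.

(** * The labeled elements of the ambient field *)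

Section Acirc.
Variables (n : nat) (hn : (2 <= n)%N) (F : fieldType).
Variable (kappa : {rmorphism fracZP n.+1 -> F}).
Variables (S0 : seed n.+1 n F) (x : chord n -> F) (hx : is_Acirc kappa S0 x).
Implicit Types (d e : chord n) (M : seq (chord n)) (S : seed n.+1 n F).
Implicit Types (a b c : 'I_n.+1).

Local Notation X := (labeled kappa x).

Let n_gt0 : (0 < n)%N. Proof. exact: ltnW. Qed.

Lemma labeled_diag d : is_diag d -> X d = x d.
Proof. by case/andP=> _ /negPf d_nside; rewrite /labeled d_nside. Qed.

Lemma labeled_theta d : #|d| = 2%N -> X (theta d) = X d.
Proof.
move=> d2; rewrite /labeled is_side_theta side_coef_theta; case: ifP => // ns.
by apply: (Acirc_theta hx); rewrite /is_diag d2 ns.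
Qed.

Lemma labeled_monomial p fs M :
  monomial_is x p fs M -> (forall d, d \in M -> #|d| = 2%N) ->
  tropF kappa p * \prod_(y <- fs) y = \prod_(d <- M) X d.
Proof.
move=> [-> perm_fs] M2.
rewrite (perm_big _ perm_fs) big_map big_filter tropF_sum.
rewrite [X in _ * X]big_mkcond -big_split /= [LHS]big_seq [RHS]big_seq.
apply: eq_bigr => d /M2 d2; rewrite /is_diag d2 /labeled /=.
case: (boolP (is_side d)) => sd /=; first by rewrite mulr1.
by rewrite (side_coef_nonside sd) (tropF0 kappa) mul1r.
Qed.

Lemma labeled_exchange d d' M1 M2 :
  exchange_data d d' M1 M2 -> is_diag d -> is_diag d' ->
  (forall e, e \in M1 ++ M2 -> #|e| = 2%N) ->
  X d * X d' = \prod_(e <- M1) X e + \prod_(e <- M2) X e.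
Proof.
move=> ed dd dd' M2card.
have [S [S' [k [_ [_ rel _ _ _]] [zz' mon]]]] := Acirc_exchange_all hx ed.
have c1 e : e \in M1 -> #|e| = 2%N.
  by move=> eM; apply: M2card; rewrite mem_cat eM.
have c2 e : e \in M2 -> #|e| = 2%N.
  by move=> eM; apply: M2card; rewrite mem_cat eM orbT.
rewrite !labeled_diag //.
have -> : x d * x d' = cluster S k * cluster S' k.
  by case: zz' => -[-> ->]; rewrite // mulrC.
rewrite rel -/(exchange_rhs kappa S k) exchange_rhs_factors.
case: mon => -[/labeled_monomial m1 /labeled_monomial m2].
  by rewrite m1 // m2.
by rewrite m1 // m2 // addrC.
Qed.

Lemma reachable_normalized S : reachable kappa S0 S -> normalized S.
Proof. by elim=> [|k T T' _ _ []] //; case: (Acirc_seed hx). Qed.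

(** If the old variable is 0 then any y in F solves the exchange relation, so all
    natural numbers are cluster variables; but these have finitely many labels. *)
Lemma mutated_variable_neq0 S S' k :
  reachable kappa S0 S -> mutation kappa k S S' -> cluster S k != 0.
Proof.
move=> rS mS; apply/eqP => Sk0.
have rhs0 : exchange_rhs kappa S k = 0.
  by rewrite /exchange_rhs; case: mS => _ <- _ _ _; rewrite Sk0 mul0r.
have lab (j : nat) : exists d, j%:R = x d.
  have [|T mT TkE] := @mutation_exists _ _ _ kappa S k j%:R.
    by rewrite Sk0 mul0r.
  have [|d _ dE] := (Acirc_variables hx j%:R).1; last by exists d.
  by exists T; [apply: reachable_mutation mT | exists k].
have [f fE] := choice lab.
have f_inj : injective (fun i : 'I_#|chord n|.+1 => f i).
  move=> i j fij; apply: val_inj; apply: (natF_inj kappa) => /=.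
  by rewrite (fE i) (fE j) fij.
by have := leq_card _ f_inj; rewrite card_ord ltnn.
Qed.

(** A relation is realized by a mutation in an unknown direction.  The old variable
    is nonzero by [mutated_variable_neq0]; for the new one, the seed is mutated
    back.  That the same exchange relation governs the way back uses that the
    exchanged variable does not occur on the right-hand side, which the hypothesis
    on labels guarantees. *)
Lemma exchanged_variables_neq0 d d' M1 M2 :
  exchange_data d d' M1 M2 -> is_diag d -> is_diag d' ->
  (forall e, e \in M1 ++ M2 -> is_diag e ->
     [/\ e != d, e != theta d, e != d' & e != theta d']) ->
  x d != 0 /\ x d' != 0.
Proof.
move=> ed dd dd' Mn.
have [S [S' [k [rS mS [zz' mon]]]]] := Acirc_exchange_all hx ed.
have rS' : reachable kappa S0 S' by apply: reachable_mutation mS.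
have Sk_n0 := mutated_variable_neq0 rS mS.
suff S'k_n0 : cluster S' k != 0.
  by case: zz' Sk_n0 S'k_n0 => -[-> ->].
apply/eqP => S'k0.
have Bkk : exmx S k k = 0.
  apply/eqP/negP => /negP/mem_factors.
  have memM : cluster S k \in factorsp S k ++ factorsm S k ->
      exists2 e, e \in M1 ++ M2 & is_diag e /\ cluster S k = x e.
    rewrite mem_cat => /orP h.
    have inM p fs M : monomial_is x p fs M -> cluster S k \in fs ->
        exists2 e, e \in M & is_diag e /\ cluster S k = x e.
      move=> [_ /perm_mem ->] /mapP[e]; rewrite mem_filter => /andP[de eM] ->.
      by exists e.
    by case: mon => -[m1 m2]; case: h => [/(inM _ _ _ m1)|/(inM _ _ _ m2)] [e eM eP];
      exists e; rewrite ?mem_cat ?eM ?orbT.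
  case/memM=> e eM [de SkE]; have [n1 n2 n3 n4] := Mn e eM de.
  case: zz' => -[E _]; rewrite E in SkE.
    by case: (Acirc_inj hx dd de SkE) n1 n2 => ->; rewrite eqxx.
  by case: (Acirc_inj hx dd' de SkE) n3 n4 => ->; rewrite eqxx.
have rhs0 : exchange_rhs kappa S' k = 0.
  rewrite (exchange_rhs_mutation (reachable_normalized rS) mS Bkk).
  by rewrite /exchange_rhs; case: mS => _ <- _ _ _; rewrite S'k0 mulr0.
have [|T mT _] := @mutation_exists _ _ _ kappa S' k 0.
  by rewrite rhs0 mulr0.
by have := mutated_variable_neq0 rS' mT; rewrite S'k0 eqxx.
Qed.

Lemma diameter_variable_neq0 a : x [set vtx a; antip (vtx a)] != 0.
Proof.
have [b ba] : exists b, a != b.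
  exists (if a == ord0 then ord_max else ord0).
  by case: (a =P ord0) => [->|/eqP //]; rewrite -val_eqE /=; lia.
have diam (u v : 'I_n.+1) : (u < v)%N -> x [set vtx u; antip (vtx u)] != 0 /\
    x [set vtx v; antip (vtx v)] != 0.
  move=> ltuv; have lv := ltn_ord v.
  apply: exchanged_variables_neq0 (diameter_exchange ltuv) _ _ _;
    rewrite ?diameter_diag // ?theta_diameter.
  by move=> e; rewrite !inE => /orP[]/eqP-> _; rewrite !vtxE !antip_natv;
    split; rewrite chord_natv_eq; lia.
have /orP[ltab|ltba] : (a < b)%N || (b < a)%N by rewrite -neq_ltn.
  by case: (diam _ _ ltab).
by case: (diam _ _ ltba).
Qed.

Local Notation Xd a := (X [set vtx a; antip (vtx a)]).

Lemma labeled_diameter_neq0 a : (Xd a) != 0.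
Proof. by rewrite labeled_diag ?diameter_variable_neq0 ?diameter_diag. Qed.

Lemma labeled_diameters a b : (a < b)%N ->
  (Xd a) * Xd b = X [set vtx a; vtx b] + X [set vtx a; antip (vtx b)].
Proof.
move=> ltab; rewrite (labeled_exchange (diameter_exchange ltab)) ?diameter_diag //.
  by rewrite !big_seq1.
by move=> e; rewrite !inE => /orP[]/eqP->; apply: card_listed; constructor.
Qed.

(** Replace X_(a, b-bar) and X_(a, c-bar) in the relation [Exchange2] by means of
    [Exchange3]; the products X_ab X_ac cancel and X_a factors out. *)
Lemma labeled_plucker a b c : (a < b)%N -> (b < c)%N ->
  X [set vtx a; vtx c] * Xd b =
  X [set vtx a; vtx b] * Xd c + (Xd a) * X [set vtx b; vtx c].
Proof.
move=> ltab ltbc; have lc := ltn_ord c; have ltac := ltn_trans ltab ltbc.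
have := labeled_exchange (half_exchange ltab ltbc).
rewrite !big_cons !big_nil !mulr1 => rel.
have {}rel : X [set vtx a; vtx c] * X [set vtx a; antip (vtx b)] =
    X [set vtx a; vtx b] * X [set vtx a; antip (vtx c)] +
    (Xd a) * ((Xd a) * X [set vtx b; vtx c]).
  apply: rel.
  - by rewrite !vtxE chord_natv_diag; lia.
  - by rewrite !vtxE antip_natv chord_natv_diag; lia.
  - move=> e; rewrite !inE => eM; apply: card_listed.
    by case/or4P: eM => [|||/orP[]] /eqP->; constructor.
have eb := labeled_diameters ltab; have ec := labeled_diameters ltac.
apply: (mulfI (labeled_diameter_neq0 a)).
have {}eb : X [set vtx a; antip (vtx b)] = (Xd a) * Xd b - X [set vtx a; vtx b].
  by rewrite eb addrC addKr.
have {}ec : X [set vtx a; antip (vtx c)] = (Xd a) * Xd c - X [set vtx a; vtx c].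
  by rewrite ec addrC addKr.
move: rel; rewrite eb ec => rel.
apply/eqP; rewrite -subr_eq0; move/eqP: rel; rewrite -subr_eq0.
by congr (_ == 0); ring.
Qed.

(** * The embedding of the Plücker ring into the ambient field *)

Definition chord_coord (i : 'I_(n.+1 + n)) : F :=
  match split i with
  | inl a => Xd a
  | inr b => X [set vtx ord0; vtx (lift ord0 b)] / Xd ord0
  end.

Local Notation plucker_ring := (in_gen_subring (@plucker_generator n.+2)).
Local Notation to_F :=
  (eval_mx (normal_mx (row1_of chord_coord) (row2_of chord_coord))).

Lemma row1_chord_coord a : row1_of chord_coord a = Xd a.
Proof. by rewrite /row1_of /chord_coord (unsplitK (inl _ a)). Qed.

Lemma row2_coord0 : row2_of chord_coord ord0 = 0.
Proof. by rewrite /row2_of unlift_none. Qed.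

Lemma row2_coord a : (0 < a)%N ->
  row2_of chord_coord a = X [set vtx ord0; vtx a] / Xd ord0.
Proof.
rewrite /row2_of; case: (unliftP ord0 a) => [b ->|-> //].
by rewrite /chord_coord (unsplitK (inr _ b)).
Qed.

Lemma to_F_diameter a : to_F (plucker (plucker_col a) ord_max) = Xd a.
Proof. by rewrite normal_mx_plucker_max row1_chord_coord. Qed.

Lemma to_F_same a b : (a < b)%N ->
  to_F (plucker (plucker_col a) (plucker_col b)) = X [set vtx a; vtx b].
Proof.
move=> ltab; rewrite normal_mx_plucker !row1_chord_coord.
have b_gt0 : (0 < b)%N by apply: leq_ltn_trans ltab.
have Xd0 := labeled_diameter_neq0 ord0.
rewrite (row2_coord b_gt0); have [a0|a_gt0] := posnP a.
  have -> : a = ord0 by apply: val_inj.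
  by rewrite row2_coord0 mulr0 subr0 mulrC divfK.
rewrite (row2_coord a_gt0); apply: (mulfI Xd0).
have rel := @labeled_plucker ord0 a b a_gt0 ltab.
have -> : Xd ord0 * X [set vtx a; vtx b] =
    X [set vtx ord0; vtx b] * Xd a - X [set vtx ord0; vtx a] * Xd b.
  by rewrite rel addrC addKr.
by field.
Qed.

Lemma to_F_opposite a b : (a < b)%N ->
  to_F (plucker (plucker_col a) ord_max * plucker (plucker_col b) ord_max
        - plucker (plucker_col a) (plucker_col b)) = X [set vtx a; antip (vtx b)].
Proof.
move=> ltab; rewrite rmorphB rmorphM /= !to_F_diameter to_F_same //.
by rewrite labeled_diameters // addrC addKr.
Qed.

Lemma plucker_col_in_ring a b : (a < b)%N ->
  plucker (plucker_col a) (plucker_col b) \in plucker_ring.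
Proof.
by move=> ltab; apply: in_gen_subring_gen; exists (plucker_col a), (plucker_col b).
Qed.

Lemma plucker_max_in_ring a :
  plucker (plucker_col a) ord_max \in plucker_ring.
Proof.
by apply: in_gen_subring_gen; exists (plucker_col a), ord_max; split => //=.
Qed.

Lemma labeled_lift d : #|d| = 2%N ->
  exists f, [/\ f \in plucker_ring, f != 0 & to_F f = X d].
Proof.
have listed e : listed_chord e -> exists f,
    [/\ f \in plucker_ring, f != 0 & to_F f = X e].
  case=> [a|a b ltab|a b ltab].
  - exists (plucker (plucker_col a) ord_max).
    by split; [exact: plucker_max_in_ring | exact: plucker_max_neq0
              | exact: to_F_diameter].
  - exists (plucker (plucker_col a) (plucker_col b)).
    by split; [exact: plucker_col_in_ring|exact: plucker_neq0|exact: to_F_same].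
  - exists (plucker (plucker_col a) ord_max * plucker (plucker_col b) ord_max
            - plucker (plucker_col a) (plucker_col b)).
    split; [|exact: plucker_bar_neq0|exact: to_F_opposite].
    by rewrite rpredB ?rpredM ?plucker_max_in_ring ?plucker_col_in_ring.
move=> d2; case: (chord_listed d2) => [/listed//|/listed[f [fS f0 fE]]].
by exists f; rewrite fE labeled_theta.
Qed.

(** A system of 2n+1 elements of the ambient field whose independence is part of
    the definition of a seed. *)
Definition initial_coord (i : 'I_(n.+1 + n)) : F :=
  match split i with
  | inl j => kappa (tofrac 'X_j)
  | inr k => cluster S0 k
  end.

(** The cluster is free over the fraction field of the ring of coefficients;
    splitting each exponent into its coefficient part and its cluster part,
    coefficients of cluster monomials vanish first, then those of the p_j. *)
Lemma initial_coord_free (f : {mpoly int[n.+1 + n]}) :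
  mmap intr initial_coord f = 0 -> f = 0.
Proof.
have [[cl_free _] _ _] := Acirc_seed hx.
pose g i : {mpoly (fracZP n.+1)[n]} :=
  match split i with inl j => (tofrac 'X_j)%:MP | inr k => 'X_k end.
have gE h : mmap kappa (cluster S0) (mmap intr g h) = mmap intr initial_coord h.
  apply: (@mpoly_int_morph_ext _ _ (mmap kappa (cluster S0) \o mmap intr g)
    (mmap intr initial_coord)) => i.
  rewrite /= !mmapX !mmap1U /g /initial_coord.
  by case: (split i) => j; rewrite ?mmapC ?mmapX ?mmap1U.
rewrite -gE => /cl_free gf0.
pose mL (m : 'X_{1..n.+1 + n}) : 'X_{1..n.+1} :=
  [multinom m (lshift n j) | j < n.+1].
pose mR (m : 'X_{1..n.+1 + n}) : 'X_{1..n} :=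
  [multinom m (rshift n.+1 k) | k < n].
have mLR_inj m m' : mL m = mL m' -> mR m = mR m' -> m = m'.
  move=> /mnmP EL /mnmP ER; apply/mnmP => i; case: (split_ordP i) => j ->.
    by have := EL j; rewrite !mnmE.
  by have := ER j; rewrite !mnmE.
have mmap1E m : mmap1 g m = (tofrac 'X_[mL m])%:MP * 'X_[mR m].
  rewrite /mmap1 big_split_ord /= !mpolyXE_id !rmorph_prod /=; congr (_ * _).
    by apply: eq_bigr => j _; rewrite /g (unsplitK (inl _ j)) mnmE !rmorphXn.
  by apply: eq_bigr => k _; rewrite /g (unsplitK (inr _ k)) mnmE.
pose P r : {mpoly int[n.+1]} :=
  \sum_(m <- msupp f | mR m == r) f@_m *: 'X_[mL m].
have P0 r : P r = 0.
  apply/eqP; rewrite -tofrac_eq0 rmorph_sum /=; apply/eqP.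
  transitivity ((mmap intr g f)@_r); last by rewrite gf0 mcoeff0.
  rewrite /mmap raddf_sum big_mkcond /=; apply: eq_bigr => m _.
  rewrite mmap1E mulrA -(rmorph_int (@mpolyC n (fracZP n.+1))) -rmorphM /=.
  rewrite mul_mpolyC.
  rewrite mcoeffZ mcoeffX; case: eqP => _; rewrite ?mulr0 // mulr1.
  by rewrite -mul_mpolyC -intr_mpolyC rmorphM rmorph_int.
apply/mpolyP => m; rewrite mcoeff0.
have [mf|] := boolP (m \in msupp f); last by move/memN_msupp_eq0.
have := congr1 (mcoeff (mL m)) (P0 (mR m)).
rewrite mcoeff0 raddf_sum /= big_mkcond (bigD1_seq m) ?msupp_uniq //= eqxx.
rewrite mcoeffZ mcoeffX eqxx mulr1 big1 ?addr0 // => m' m'm.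
case: eqP => // mR'; rewrite mcoeffZ mcoeffX.
case: eqP => [mL'|]; last by rewrite mulr0.
by case/eqP: m'm; apply: mLR_inj.
Qed.

(** The elements of [initial_coord] are labeled elements, hence polynomials in the
    entries [chord_coord]; the latter are therefore independent, and [to_F] is
    evaluation on a generic normal form. *)
Lemma to_F_faithful f : f \in plucker_ring ->
  to_F f = 0 -> f = 0.
Proof.
move=> fS; rewrite eval_normal_mx_comp => f0; apply: (normal_mx_faithful fS).
have sig i : exists h : {mpoly int[n.+1 + n]},
    mmap intr chord_coord h = initial_coord i.
  suff [d d2 <-] : exists2 d : chord n, #|d| = 2%N & X d = initial_coord i.
    have [h [_ _ <-]] := labeled_lift d2.
    by rewrite eval_normal_mx_comp; eexists.
  rewrite /initial_coord; case: (split i) => [j|k].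
    have sj : is_side [set vtx j; vtx j + 1] by apply/existsP; exists (vtx j).
    exists [set vtx j; vtx j + 1]; first exact: card_side.
    by rewrite /labeled sj side_coef_vtx // tropF_delta.
  have [|d dd ->] := (Acirc_variables hx (cluster S0 k)).1.
    by exists S0; [exact: reachable_init | exists k].
  by exists d; [case/andP: dd => /eqP | rewrite labeled_diag].
have [h hE] := choice sig.
exact: (alg_independent_of_polynomials hE initial_coord_free f0).
Qed.

Lemma variable_neq0 d : is_diag d -> x d != 0.
Proof.
move=> dd; have /andP[/eqP d2 _] := dd.
have [f [fS f0 fE]] := labeled_lift d2.
by rewrite -(labeled_diag dd) -fE; apply: contra_neq f0; apply: to_F_faithful.
Qed.

(** The coefficients of a seed are read off from its mutations, and a mutation at k
    exists because the exchanged variable is nonzero. *)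
Lemma coefficient_monomial S k : reachable kappa S0 S ->
  exists Mp Mm, coef_pos S k = monomial_coef Mp /\ coef_neg S k = monomial_coef Mm.
Proof.
move=> rS.
have [|d dd SkE] := (Acirc_variables hx (cluster S k)).1.
  by exists S => //; exists k.
have Sk0 : cluster S k != 0 by rewrite SkE variable_neq0.
have [|S' mS _] := @mutation_exists _ _ _ kappa S k
    (exchange_rhs kappa S k / cluster S k).
  by rewrite mulrC divfK.
have [_ [_ [M1 [M2 [_ [_ mon]]]]]] := Acirc_exchange hx rS mS.
case: mon => -[[p1 _] [p2 _]]; first by exists M1, M2.
by exists M2, M1.
Qed.

Lemma cluster_generator_labeled (P : F -> Prop) :
  P 1 -> (forall y z, P y -> P z -> P (y * z)) ->
  (forall d, #|d| = 2%N -> P (X d)) ->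
  forall y, cluster_generator kappa S0 y -> P y.
Proof.
move=> P1 PM PX.
have Pcoef M : P (tropF kappa (monomial_coef M)).
  rewrite tropF_sum; elim/big_rec: _ => // d y _; apply: PM.
  have [sd|nsd] := boolP (is_side d).
    by have := PX d (card_side sd); rewrite /labeled sd.
  by rewrite (side_coef_nonside nsd) (tropF0 kappa).
move=> _ [S i rS|S i rS|S i rS].
- have [|d dd ->] := (Acirc_variables hx (cluster S i)).1.
    by exists S => //; exists i.
  by rewrite -labeled_diag //; apply: PX; case/andP: dd => /eqP.
- by have [Mp [_ [-> _]]] := coefficient_monomial i rS.
- by have [_ [Mm [_ ->]]] := coefficient_monomial i rS.
Qed.

(** The generator p_d of a side d = [v, v + 1] is itself a coefficient, in the
    exchange of the diameters through v and v + 1: d is alone in one of the two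
    monomials. *)
Lemma labeled_cluster_generator d : #|d| = 2%N -> cluster_generator kappa S0 (X d).
Proof.
move=> d2; have [sd|nsd] := boolP (is_side d).
  have /existsP[v /eqP dE] := sd.
  have [S [S' [k [rS _ [_ mon]]]]] := Acirc_exchange_all hx (side_exchange v n_gt0).
  have cE : monomial_coef [:: d] = side_coef d by rewrite /monomial_coef big_seq1.
  rewrite /labeled sd -cE dE.
  case: mon => -[[m1 _] [m2 _]].
    by rewrite -m1; apply: cluster_generator_coef_pos.
  by rewrite -m2; apply: cluster_generator_coef_neg.
have dd : is_diag d by rewrite /is_diag d2.
rewrite labeled_diag //; have [|S rS [i ->]] := (Acirc_variables hx (x d)).2.
  by exists d.
exact: cluster_generator_var.
Qed.

Lemma plucker_labeled f : plucker_generator f ->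
  exists2 d : chord n, #|d| = 2%N & to_F f = X d.
Proof.
move=> [_ [_ [/plucker_col_lt[a -> [->|[b -> ltab]]] ->]]].
  exists [set vtx a; antip (vtx a)]; last exact: to_F_diameter.
  by apply: card_listed; constructor.
exists [set vtx a; vtx b]; last exact: to_F_same.
by apply: card_listed; constructor.
Qed.

(** Since [to_F] is injective on the Plücker ring, both rings are the same subring
    of the ambient field as soon as their generators match. *)
Lemma cluster_algebra_iso_ZX :
  exists2 phi : {rmorphism cluster_algebra kappa S0 -> ZX n.+2},
    bijective phi & forall u, to_F (val (phi u)) = val u.
Proof.
apply: (gen_subring_iso to_F_faithful) => [f /plucker_labeled[d d2 fE]|y Gy].
  by have := in_gen_subring_gen (labeled_cluster_generator d2); rewrite -fE.
apply: (cluster_generator_labeled (P := fun y => exists2 f,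
  f \in plucker_ring & to_F f = y)) Gy.
- by exists 1; rewrite ?rpred1 ?rmorph1.
- move=> _ _ [f fS <-] [g gS <-]; exists (f * g); first exact: rpredM.
  exact: rmorphM.
- by move=> d /labeled_lift[f [fS _ fE]]; exists f.
Qed.

Lemma inverse_extends_correspondence (phi : cluster_algebra kappa S0 -> ZX n.+2) :
  (forall u, to_F (val (phi u)) = val u) -> extends_correspondence x phi.
Proof.
move=> phiE.
have phi_sends d f : listed_chord d -> f \in plucker_ring -> to_F f = X d ->
    sends x phi d f.
  move=> /card_listed d2 fS fE.
  exists (GenSubring (in_gen_subring_gen (labeled_cluster_generator d2))) => //.
  apply/eqP; rewrite -subr_eq0; apply/eqP/to_F_faithful.
    by rewrite rpredB //; exact: valP.
  by rewrite rmorphB /= [to_F (val _)]phiE fE subrr.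
split=> [a|a b ltab|a b ltab]; apply: phi_sends; try constructor => //.
- exact: plucker_max_in_ring.
- exact: to_F_diameter.
- exact: plucker_col_in_ring.
- exact: to_F_same.
- by rewrite rpredB ?rpredM ?plucker_max_in_ring ?plucker_col_in_ring.
- exact: to_F_opposite.
Qed.

(** Every generator of the cluster algebra is a product of labeled elements, on
    which two extensions agree by hypothesis. *)
Lemma extension_unique (phi psi : {rmorphism cluster_algebra kappa S0 -> ZX n.+2}) :
  extends_correspondence x phi -> extends_correspondence x psi -> psi =1 phi.
Proof.
move=> phi_ext psi_ext u.
pose agree y := exists2 v : cluster_algebra kappa S0, val v = y & psi v = phi v.
suff [v /val_inj -> //] : agree (val u).
have agree1 : agree 1 by exists 1; rewrite ?rmorph1.
have agreeM y z : agree y -> agree z -> agree (y * z).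
  by move=> [v <- Ev] [w <- Ew]; exists (v * w); rewrite ?rmorphM ?Ev ?Ew.
apply: (gen_subring_sub (S := agree)) (valP u) => //.
  by move=> _ _ [v <- Ev] [w <- Ew]; exists (v - w); rewrite ?rmorphB ?Ev ?Ew.
apply: cluster_generator_labeled => //.
have agree_sends d f : sends x phi d f -> sends x psi d f -> agree (X d).
  move=> [v vE phi_v] [w wE psi_w]; exists v => //.
  have -> : v = w by apply: val_inj; rewrite vE wE.
  apply: val_inj; rewrite psi_w -phi_v; congr (val (phi _)).
  by apply: val_inj; rewrite vE.
have agree_listed d : listed_chord d -> agree (X d).
  have [phi1 phi2 phi3] := phi_ext; have [psi1 psi2 psi3] := psi_ext.
  by case=> [a|a b ltab|a b ltab];
    [exact: agree_sends (phi1 a) (psi1 a)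
    |exact: agree_sends (phi2 a b ltab) (psi2 a b ltab)
    |exact: agree_sends (phi3 a b ltab) (psi3 a b ltab)].
move=> d d2; case: (chord_listed d2) => [|/agree_listed]; first exact: agree_listed.
by rewrite labeled_theta.
Qed.

End Acirc.

Theorem proposition12p11 (n : nat) (hn : (2 <= n)%N)
    (F : fieldType) (kappa : {rmorphism fracZP n.+1 -> F})
    (hF : is_ambient_field n kappa)
    (S0 : seed n.+1 n F) (x : chord n -> F) (hx : is_Acirc kappa S0 x) :
  exists phi : {rmorphism cluster_algebra kappa S0 -> ZX n.+2},
    [/\ bijective phi,
        extends_correspondence x phi
      & forall psi : {rmorphism cluster_algebra kappa S0 -> ZX n.+2},
          bijective psi -> extends_correspondence x psi -> psi =1 phi].
Proof.
have [phi phi_bij phiE] := cluster_algebra_iso_ZX hn hx.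
have phi_ext := inverse_extends_correspondence hn hx phiE.
exists phi; split=> // psi _ psi_ext.
exact: (extension_unique hn hx phi_ext psi_ext).
Qed.
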